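(* Let $u:\mathbb{N}_0\to\mathbb{R}$ be finitely supported with $u(0)=u(1)=0$. Then $$\sum_{n=0}^\infty |\Delta u(n)|^2 \geq \frac{5}{16} \sum_{n=1}^\infty \frac{|u(n)|^2}{n^4}.$$
   Context: $\mathbb{N}_0=\{0,1,2,\dots\}$. For $u:\mathbb{N}_0\to\mathbb{R}$, the Laplacian on $\mathbb{N}_0$ is $\Delta u(n):=2u(n)-u(n-1)-u(n+1)$ for $n\geq 1$, and $\Delta u(0):=u(0)-u(1)$. *)

(* Defs.v *)
From HB Require Import structures.
From mathcomp Require Import all_boot all_order all_algebra.
From mathcomp Require Import all_classical all_reals all_analysis.
Set Implicit Arguments.
Unset Strict Implicit.
Unset Printing Implicit Defensive.
Import Order.TTheory GRing.Theory Num.Theory.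
Import numFieldNormedType.Exports.
Local Open Scope classical_set_scope.
Local Open Scope ring_scope.

Definition laplacian (R : realType) (u : nat -> R) (n : nat) : R :=
  match n with
  | 0%N => u 0%N - u 1%N
  | k.+1 => 2 * u k.+1 - u k - u k.+2
  end.

Definition finitely_supported (R : realType) (u : nat -> R) : Prop :=
  finite_set [set n | u n != 0].

(* Main.v *)
Require Import Defs.
From mathcomp Require Import all_boot all_order all_algebra.
From mathcomp Require Import all_classical all_reals all_analysis.
From mathcomp Require Import ring lra.
Import Order.TTheory GRing.Theory Num.Theory.
Import numFieldNormedType.Exports.
Local Open Scope classical_set_scope.
Local Open Scope ring_scope.

(** With [v n = u n.+1 - u n] one has [laplacian u n.+1 = v n - v n.+1], and
    [v 0 = 0], so the inequality follows from two discrete Hardy inequalities: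
      sum |v n - v (n-1)|^2 >= 1/4 * sum |v n|^2 / n^2,
      sum |v n|^2 / n^2     >= 2 * sum |u n|^2 / n^4,
    which together give the constant 1/2 >= 5/16.

    Both come from the ground-state method.  For positive [g], writing
    [g (n+1) / g n = 1 + s], one has
      (y - x)^2 >= s / (1 + s) * y^2 - s * x^2     ([ground_state_le]),
    with equality when y / x = g (n+1) / g n.  For the first inequality the
    continuous ground state is [sqrt n], and the rational choice [s = 1 / (2 n)]
    has the same leading order.  For the second, [n^(3/2)] would give the
    sharp continuous constant 9/4, but [g n = n], that is [s = 1 / n], already
    gives 2.  In both cases the remaining terms telescope
    ([hardy_step], [weighted_hardy_step]), and the boundary terms are
    nonnegative at the upper end and vanish at the lower end because
    [u 0 = u 1 = 0].  Hence the inequality holds between partial sums, and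
    passes to the limit. *)

Section GroundState.
Context {F : realFieldType}.
Implicit Types s x y a : F.

(** The two sides differ by [(y - (1 + s) x)^2 / (1 + s)]. *)
Lemma ground_state_le s x y : 0 < 1 + s ->
  s / (1 + s) * y ^+ 2 - s * x ^+ 2 <= (y - x) ^+ 2.
Proof.
move=> s1; rewrite -subr_ge0.
have -> : (y - x) ^+ 2 - (s / (1 + s) * y ^+ 2 - s * x ^+ 2) =
          (y - (1 + s) * x) ^+ 2 / (1 + s) by field; lra.
by rewrite divr_ge0 ?sqr_ge0 // ltW.
Qed.

(** Uses [s = 1 / (2 a)], for which [s / (1 + s) = 1 / (2 a + 1)]; the gain is
    [1 / (2 a + 1) - 1 / (2 a + 2) >= 1 / (4 (a + 1)^2)]. *)
Lemma hardy_step a x y : 0 < a ->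
  y ^+ 2 / (4 * (a + 1) ^+ 2) + y ^+ 2 / (2 * (a + 1)) - x ^+ 2 / (2 * a)
    <= (y - x) ^+ 2.
Proof.
move=> a0; have s0 : 0 < 1 + (2 * a)^-1 by rewrite addr_gt0 ?invr_gt0 ?mulr_gt0.
apply: le_trans (ground_state_le _ x y s0); rewrite -subr_ge0.
set d := (X in 0 <= X).
have -> : d = y ^+ 2 / (4 * (a + 1) ^+ 2 * (2 * a + 1)).
  by rewrite /d; field; do ?[apply/andP; split]; lra.
by rewrite divr_ge0 ?sqr_ge0 // !mulr_ge0 ?sqr_ge0 //; lra.
Qed.

(** Uses [s = 1 / a], for which [s / (1 + s) = 1 / (a + 1)]; the gain is
    [1 / (a^2 (a + 1)) - 1 / (a + 1)^3 >= 2 / (a + 1)^4]. *)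
Lemma weighted_hardy_step a x y : 0 < a ->
  2 * (y ^+ 2 / (a + 1) ^+ 4) + y ^+ 2 / (a + 1) ^+ 3 - x ^+ 2 / a ^+ 3
    <= (y - x) ^+ 2 / a ^+ 2.
Proof.
move=> a0; have s0 : 0 < 1 + a^-1 by rewrite addr_gt0 ?invr_gt0.
have a20 : 0 < a ^+ 2 by rewrite exprn_gt0.
rewrite ler_pdivlMr//; apply: le_trans (ground_state_le _ x y s0).
rewrite -subr_ge0; set d := (X in 0 <= X).
have -> : d = (3 * a + 1) * y ^+ 2 / (a + 1) ^+ 4.
  by rewrite /d; field; do ?[apply/andP; split]; lra.
by apply: divr_ge0; [apply: mulr_ge0; [lra | exact: sqr_ge0] | apply: exprn_ge0; lra].
Qed.

End GroundState.

Section PartialSums.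
Context {R : realType}.
Implicit Types u v : nat -> R.

Lemma telescoping_step (lhs rhs dl dr b b' : R) :
  lhs + b <= rhs -> dl + b' - b <= dr -> lhs + dl + b' <= rhs + dr.
Proof. lra. Qed.

(** The boundary term [v N ^+ 2 / (2 * N%:R)] at [N = 0] is [0 / 0 = 0]; the
    first step, where [hardy_step] would need [a = 0], is done directly. *)
Lemma hardy_partial_sum v N : v 0%N = 0 ->
  \sum_(k < N) v k.+1 ^+ 2 / (4 * k.+1%:R ^+ 2) + v N ^+ 2 / (2 * N%:R)
    <= \sum_(k < N) (v k.+1 - v k) ^+ 2.
Proof.
move=> v0; elim: N => [|N IH]; first by rewrite !big_ord0 v0 expr0n !mul0r addr0.
rewrite !big_ord_recr/=; move: IH; case: N => [|N] IH.
  rewrite !big_ord0 v0 !subr0 expr1n; have := sqr_ge0 (v 1%N); lra.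
apply: telescoping_step IH _; rewrite -(natr1 N.+1).
exact: hardy_step (ltr0Sn R N).
Qed.

Lemma weighted_hardy_partial_sum u N : u 1%N = 0 ->
  2 * \sum_(k < N) u k.+2 ^+ 2 / k.+2%:R ^+ 4 + u N.+1 ^+ 2 / N.+1%:R ^+ 3
    <= \sum_(k < N) (u k.+2 - u k.+1) ^+ 2 / k.+1%:R ^+ 2.
Proof.
move=> u1; elim: N => [|N IH].
  by rewrite !big_ord0 u1 expr0n mul0r mulr0 addr0.
rewrite !big_ord_recr/= mulrDr.
apply: telescoping_step IH _; rewrite -(natr1 N.+1).
exact: weighted_hardy_step (ltr0Sn R N).
Qed.

Lemma rellich_partial_sum u N : u 0%N = 0 -> u 1%N = 0 ->
  1 / 2 * \sum_(k < N) u k.+2 ^+ 2 / k.+2%:R ^+ 4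
    <= \sum_(k < N) laplacian u k.+1 ^+ 2.
Proof.
move=> u0 u1; pose v n := u n.+1 - u n.
have v0 : v 0%N = 0 by rewrite /v u0 u1 subr0.
have -> : \sum_(k < N) laplacian u k.+1 ^+ 2 = \sum_(k < N) (v k.+1 - v k) ^+ 2.
  by apply: eq_bigr => k _; rewrite /v /=; ring.
have H1 : \sum_(k < N) v k.+1 ^+ 2 / (4 * k.+1%:R ^+ 2) <=
    \sum_(k < N) (v k.+1 - v k) ^+ 2.
  apply: le_trans (hardy_partial_sum v N v0).
  by rewrite lerDl divr_ge0 ?sqr_ge0 ?mulr_ge0.
have H2 : 2 * \sum_(k < N) u k.+2 ^+ 2 / k.+2%:R ^+ 4 <=
    \sum_(k < N) v k.+1 ^+ 2 / k.+1%:R ^+ 2.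
  apply: le_trans (weighted_hardy_partial_sum u N u1).
  by rewrite lerDl divr_ge0 ?sqr_ge0 ?exprn_ge0.
have E : \sum_(k < N) v k.+1 ^+ 2 / (4 * k.+1%:R ^+ 2) =
    1 / 4 * \sum_(k < N) v k.+1 ^+ 2 / k.+1%:R ^+ 2.
  by rewrite mulr_sumr; apply: eq_bigr => k _; rewrite invfM; ring.
rewrite {}E in H1; lra.
Qed.

End PartialSums.

Theorem corollary2p4 (R : realType) (u : nat -> R)
  (u_fin : finitely_supported u) (u0 : u 0%N = 0) (u1 : u 1%N = 0) :
  (\sum_(0 <= n <oo) (`|laplacian u n| ^+ 2)%:E >=
    (5 / 16)%:E * \sum_(1 <= n <oo) (`|u n| ^+ 2 / n%:R ^+ 4)%:E)%E.
Proof.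
have w_ge0 n : 0 <= `|u n| ^+ 2 / n%:R ^+ 4.
  by rewrite divr_ge0 ?exprn_ge0.
rewrite -nneseriesZl; [|by move=> n _; rewrite lee_fin..].
apply: lime_le.
  by apply: is_cvg_nneseries => n _ _; rewrite mule_ge0 ?lee_fin//; lra.
near=> N.
have /subnKC <- : (2 <= N)%N by near: N; exact: nbhs_infty_ge.
move: (N - 2)%N => M; rewrite add2n.
apply: (@le_trans _ _ (\sum_(0 <= n < M.+1) (`|laplacian u n| ^+ 2)%:E)%E); last first.
  by apply: nneseries_lim_ge => n _; rewrite lee_fin exprn_ge0.
under eq_bigr do rewrite -EFinM.
rewrite !sumEFin lee_fin -mulr_sumr.
rewrite big_nat_recl// [leRHS]big_nat_recl//= u0 u1 subrr normr0 expr0n mul0r !add0r.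
rewrite big_add1 !big_mkord /=.
under eq_bigr do rewrite real_normK ?num_real//.
under [leRHS]eq_bigr do rewrite real_normK ?num_real//.
apply: le_trans (rellich_partial_sum u M u0 u1).
apply: ler_wpM2r; last lra.
by apply: sumr_ge0 => k _; rewrite divr_ge0 ?sqr_ge0 ?exprn_ge0.
Unshelve. all: by end_near.
Qed.
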